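(* Let $d\ge 2$. For any $d$ mass assignments $\mu_1,\dots,\mu_d$ on the vertical planes of $\mathbb{R}^d$, there exist a vertical plane $H$ and an axis-parallel wedge in $H$ (possibly degenerate) that bisects each of the $d$ mass distributions $\mu_1^H,\dots,\mu_d^H$.
   Context: A vertical plane in $\mathbb{R}^d$ is a 2-dimensional linear subspace containing $e_d=(0,\dots,0,1)$. For a vertical plane $H$, its vertical direction is $e_d$ and its horizontal direction is the direction in $H$ orthogonal to $e_d$. An axis-parallel wedge in $H$ is the closed region bounded by two rays from a common point $p\in H$, one in a vertical direction and one in a horizontal direction; degenerate cases (closed half-planes bounded by a vertical or horizontal line) are allowed. A wedge bisects a measure if the wedge and the closure of its complement in $H$ have equal measure. A mass distribution on $H$ is a probability measure absolutely continuous with respect to Lebesgue measure on $H$; a mass assignment on the vertical planes is an assignment $H\mapsto\mu^H$ of a mass distribution on each vertical plane $H$, depending continuously on $H$. *)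

(* Defs.v *)
From HB Require Import structures.
From mathcomp Require Import all_boot all_order all_algebra.
From mathcomp Require Import all_classical all_reals all_analysis.
Set Implicit Arguments. Unset Strict Implicit. Unset Printing Implicit Defensive.
Import Order.TTheory GRing.Theory Num.Theory.
Import numFieldNormedType.Exports.
Local Open Scope classical_set_scope.
Local Open Scope ring_scope.

(* A vertical plane H of R^d is span(u, e_d) for a horizontal unit vector u
   (u_d = 0, |u|_2 = 1); u and -u give the same plane.  The plane is
   identified with R*R via the (isometric) coordinates (s,t) |-> s u + t e_d,
   so s is the horizontal and t the vertical coordinate. *)
Definition horizontal_unit (R : realType) (d : nat) (u : 'rV[R]_d) : Prop :=
  (forall i : 'I_d, val i = d.-1 -> u ord0 i = 0) /\
  \sum_(i < d) u ord0 i ^+ 2 = 1.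

Definition lebesgue2 (R : realType) :=
  ((@lebesgue_measure R) \x (@lebesgue_measure R))%E.

Definition mass_distribution (R : realType) (mu : probability (R * R)%type R)
  : Prop :=
  forall A : set (R * R)%type, measurable A -> @lebesgue2 R A = 0%E -> mu A = 0%E.

Definition hflip (R : realType) (x : (R * R)%type) : (R * R)%type := (- x.1, x.2).

(* A mass assignment on the vertical planes, given as a function of the
   horizontal unit vector u: each mu u is a mass distribution, mu u and mu (-u)
   describe the same measure on the same plane (coordinates flipped), and
   H |-> mu^H is continuous for the weak topology of measures. *)
Definition mass_assignment (R : realType) (d : nat)
  (mu : 'rV[R]_d -> probability (R * R)%type R) : Prop :=
  [/\ (forall u, horizontal_unit u -> mass_distribution (mu u)),
      (forall u, horizontal_unit u -> forall A : set (R * R)%type,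
          measurable A -> mu (- u) A = mu u (@hflip R @^-1` A)) &
      (forall g : (R * R)%type -> R, continuous g ->
          (exists M : R, forall x, `|g x| <= M) ->
          {within [set u | horizontal_unit u],
             continuous (fun u => fine (\int[mu u]_x (g x)%:E))})].

Definition sgnb (R : realType) (b : bool) : R := if b then 1 else -1.

Definition quadrant (R : realType) (a b : R) (sh sv : bool) : set (R * R)%type :=
  [set x | 0 <= sgnb R sh * (x.1 - a) /\ 0 <= sgnb R sv * (x.2 - b)].

(* axis-parallel wedges (both closed regions bounded by the two rays),
   including the degenerate half-planes bounded by a vertical or horizontal
   line *)
Definition axis_wedge (R : realType) (W : set (R * R)%type) : Prop :=
  exists (a b : R) (sh sv : bool),
    W = quadrant a b sh sv \/
    W = [set x | sgnb R sh * (x.1 - a) <= 0 \/ sgnb R sv * (x.2 - b) <= 0] \/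
    W = [set x | 0 <= sgnb R sh * (x.1 - a)] \/
    W = [set x | 0 <= sgnb R sv * (x.2 - b)].

Definition bisects (R : realType) (mu : probability (R * R)%type R)
  (W : set (R * R)%type) : Prop :=
  mu W = mu (closure (~` W)).

(* Main.v *)
(* A wedge [{x >= A, y >= B}] with [A, B] in [-oo, +oo] is encoded by the
   parameters [a, b] in [-1, 1] with [A = a / (1 - |a|)], [B = b / (1 - |b|)].
   Let [f_k(u, a, b)] be the [mu_k^u]-measure of the wedge minus 1/2.  It is
   continuous on [S^(d-2) x [-1, 1] x [-1, 1]], and
   - [f(-u, -a, -1) = - f(u, a, -1)]: opposite vertical half-planes;
   - [f(-u, a, b) = f(u, a, b)] for [a = 1] (empty wedge) and [a = -1]
     (horizontal half-plane, which does not depend on the sign of [u]);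
   - [f(-u, -a, 1) = f(u, a, 1)]: empty wedges.
   A map to [R^d] with these symmetries has a zero.  Otherwise, fix signs
   [s_i(v)] of [f_i(v)], with ties broken equivariantly.  The mod 2 cochains
   [s_k(v_0) (s_(k-1)(v_0) + s_(k-1)(v_1)) ... (s_0(v_(k-1)) + s_0(v_k))] pair
   to 1 with symmetric cycles built by iterated suspension: the spheres
   [S^k x {0} x {-1}], then [S^(d-2) x [-1, 1] x {-1}].  By evenness on the rest of the
   boundary, the coboundary of the cochain of degree [d - 1] pairs to 1 with
   [S^(d-2) x [-1, 1] x [-1, 1]], so on some arbitrarily small simplex each of
   [f_0, ..., f_(d-1)] changes sign, and compactness yields a zero. *)

Require Import Defs.
From HB Require Import structures.
From mathcomp Require Import all_boot all_order all_algebra.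
From mathcomp Require Import all_classical all_reals all_analysis.
From mathcomp Require Import measurable_realfun ring lra.
Set Implicit Arguments. Unset Strict Implicit. Unset Printing Implicit Defensive.
Import Order.TTheory GRing.Theory Num.Theory.
Import numFieldNormedType.Exports.

(** * Mod 2 chains of ordered simplices *)

Section Chains.

(* A chain is a list of ordered simplices, a cochain a boolean predicate; chains
   are only compared through the values of all cochains on them. *)
Definition ev {X : Type} (phi : seq X -> bool) (c : seq (seq X)) : bool :=
  \big[addb/false]_(s <- c) phi s.

(** The boundary is augmented: a single vertex has the empty simplex as its face, so a 0-cycle has
    an even number of vertices. *)
Fixpoint bd {X : Type} (s : seq X) : seq (seq X) :=
  if s is x :: s' then s' :: map (cons x) (bd s') else [::].

Definition bdc {X : Type} (c : seq (seq X)) := flatten (map bd c).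

(* The sum over [j] of [p v_0, ..., p v_j, q v_j, ..., q v_k]. *)
Fixpoint prism {X Y : Type} (p q : X -> Y) (s : seq X) : seq (seq Y) :=
  if s is x :: s' then
    (p x :: q x :: map q s') :: map (cons (p x)) (prism p q s')
  else [::].

Definition prismc {X Y : Type} (p q : X -> Y) (c : seq (seq X)) :=
  flatten (map (prism p q) c).

(** A homotopy cut into [N] layers of prisms; thin layers keep the simplices small. *)
Fixpoint sweep {X Y : Type} (p : nat -> X -> Y) (N : nat) (c : seq (seq X)) :=
  if N is N'.+1 then sweep p N' c ++ prismc (p N') (p N) c else [::].

Lemma ev_cat X (phi : seq X -> bool) c c' :
  ev phi (c ++ c') = ev phi c (+) ev phi c'.
Proof. by rewrite /ev big_cat. Qed.

Lemma ev_cons X (phi : seq X -> bool) s c :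
  ev phi (s :: c) = phi s (+) ev phi c.
Proof. by rewrite /ev big_cons. Qed.

Lemma ev_nil X (phi : seq X -> bool) : ev phi [::] = false.
Proof. by rewrite /ev big_nil. Qed.

Lemma ev_map X Y (g : seq X -> seq Y) phi c :
  ev phi (map g c) = ev (phi \o g) c.
Proof. by rewrite /ev big_map. Qed.

Lemma ev_flatten X Y (g : seq X -> seq (seq Y)) phi c :
  ev phi (flatten (map g c)) = ev (fun s => ev phi (g s)) c.
Proof. by rewrite /ev big_flatten big_map. Qed.

Lemma ev_add X (phi psi : seq X -> bool) c :
  ev (fun s => phi s (+) psi s) c = ev phi c (+) ev psi c.
Proof. by rewrite /ev big_split. Qed.

Lemma ev_false X (c : seq (seq X)) : ev (fun=> false) c = false.
Proof. by rewrite /ev big1. Qed.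

Lemma ev_andl X b (phi : seq X -> bool) c :
  ev (fun s => b && phi s) c = b && ev phi c.
Proof. by case: b => //; exact: ev_false. Qed.

Lemma eq_ev X (phi psi : seq X -> bool) c :
  phi =1 psi -> ev phi c = ev psi c.
Proof. by move=> e; rewrite /ev; apply: eq_bigr => s _; exact: e. Qed.

Lemma eq_in_ev (X : eqType) (phi psi : seq X -> bool) c :
  {in c, phi =1 psi} -> ev phi c = ev psi c.
Proof.
by move=> e; rewrite /ev big_seq [RHS]big_seq; apply: eq_bigr => s /e.
Qed.

Lemma ev_bdc X (phi : seq X -> bool) c :
  ev phi (bdc c) = ev (fun s => ev phi (bd s)) c.
Proof. exact: ev_flatten. Qed.

Lemma bd_map X Y (g : X -> Y) s : bd (map g s) = map (map g) (bd s).
Proof.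
elim: s => //= x s ->; congr (_ :: _); rewrite -!map_comp.
exact: eq_map.
Qed.

Lemma bdc_map X Y (g : X -> Y) c :
  bdc (map (map g) c) = map (map g) (bdc c).
Proof.
rewrite /bdc map_flatten -!map_comp; congr flatten.
by apply: eq_map => s /=; rewrite bd_map.
Qed.

(** The chain homotopy formula mod 2: inner faces cancel in pairs. The induction is over all [phi],
    since peeling off a vertex replaces [phi] by [phi \o cons (p x)]. *)
Lemma ev_bd_prism X Y (p q : X -> Y) phi s :
  ev phi (bdc (prism p q s)) =
  phi (map q s) (+) phi (map p s) (+) ev phi (prismc p q (bd s)).
Proof.
elim: s phi => [|x s IH] phi; first by rewrite /bdc /= !ev_nil addbb.
rewrite /bdc /prismc /= !ev_cons -!/(bdc _) -!/(prismc _ _ _) !ev_cat.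
rewrite ev_bdc !ev_map.
have -> : ev ((fun s0 => ev phi (bd s0)) \o cons (p x)) (prism p q s) =
  ev phi (prism p q s) (+) ev (phi \o cons (p x)) (bdc (prism p q s)).
  rewrite ev_bdc -ev_add; apply: eq_ev => t /=.
  by rewrite ev_cons ev_map.
have -> : ev phi (prismc p q [seq x :: i | i <- bd s]) =
  ev (phi \o cons (p x) \o cons (q x)) (map (map q) (bd s)) (+)
  ev (phi \o cons (p x)) (prismc p q (bd s)).
  rewrite !ev_flatten !ev_map -ev_add.
  by apply: eq_ev => t /=; rewrite ev_cons ev_map.
rewrite IH /= bd_map.
move: (phi (q x :: _)) (phi (p x :: map q s)) (phi (p x :: map p s)).
move: (ev _ (map _ _)) (ev phi _) (ev _ (prismc _ _ _)).
by do 6![case].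
Qed.

(** The prism formula telescopes: every intermediate copy of [c] appears twice. *)
Lemma ev_bd_sweep X Y (p : nat -> X -> Y) N phi c :
  ev phi (bdc (sweep p N c)) =
  ev phi (map (map (p N)) c) (+) ev phi (map (map (p 0)) c)
  (+) ev phi (sweep p N (bdc c)).
Proof.
elim: N => [|N IH] /=; first by rewrite addbb /bdc /= !ev_nil.
rewrite {1}/bdc map_cat flatten_cat -!/(bdc _) !ev_cat IH.
have -> : ev phi (bdc (prismc (p N) (p N.+1) c)) =
  ev phi (map (map (p N.+1)) c) (+) ev phi (map (map (p N)) c) (+)
  ev phi (prismc (p N) (p N.+1) (bdc c)).
  rewrite ev_bdc /prismc ev_flatten.
  under eq_ev do rewrite -ev_bdc ev_bd_prism.
  rewrite !ev_add !ev_map ev_flatten ev_bdc; congr (_ (+) _).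
  by apply: eq_ev => s; rewrite /prismc ev_flatten.
move: (ev phi (map _ c)) (ev phi (map (map (p 0)) c)) => a b.
move: (ev phi (map _ c)) (ev phi (sweep _ _ _)) (ev phi (prismc _ _ _)) => e f g.
by case: a; case: b; case: e; case: f; case: g.
Qed.

(** Presents the value on a sweep as a cochain on [c], so that facts about all cochains on [c], such
    as vanishing on the boundary of a cycle, transfer to its sweep. *)
Lemma ev_sweep X Y (p : nat -> X -> Y) N phi c :
  ev phi (sweep p N c) = ev (fun s => ev phi (sweep p N [:: s])) c.
Proof.
elim: N => [|N IH] /=; first by rewrite ev_nil ev_false.
rewrite ev_cat IH /prismc ev_flatten -ev_add; apply: eq_ev => s.
by rewrite ev_cat /prismc /= cats0.
Qed.

Lemma map_prism X Y Z (g : Y -> Z) (p q : X -> Y) s :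
  map (map g) (prism p q s) = prism (g \o p) (g \o q) s.
Proof.
elim: s => //= x s <-; rewrite -map_comp; congr (_ :: _).
by rewrite -!map_comp; apply: eq_map.
Qed.

Lemma map_sweep X Y Z (g : Y -> Z) (p : nat -> X -> Y) N c :
  map (map g) (sweep p N c) = sweep (fun i => g \o p i) N c.
Proof.
elim: N => //= N <-; rewrite map_cat /prismc map_flatten -map_comp.
by congr (_ ++ flatten _); apply: eq_map => s /=; rewrite map_prism.
Qed.

Lemma prism_map X Y Z (g : X -> Y) (p q : Y -> Z) s :
  prism p q (map g s) = prism (p \o g) (q \o g) s.
Proof. by elim: s => //= x s ->; rewrite -map_comp. Qed.

Lemma sweep_map X Y Z (g : X -> Y) (p : nat -> Y -> Z) N c :
  sweep p N (map (map g) c) = sweep (fun i => p i \o g) N c.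
Proof.
elim: N => //= N <-; rewrite /prismc -map_comp.
by congr (_ ++ flatten _); apply: eq_map => s /=; rewrite prism_map.
Qed.

Lemma eq_in_prism (X : eqType) Y (p p' q q' : X -> Y) s :
  {in s, p =1 p'} -> {in s, q =1 q'} -> prism p q s = prism p' q' s.
Proof.
elim: s => //= x s IH pp qq.
rewrite IH; last 2 first.
- by move=> y ys; apply: pp; rewrite inE ys orbT.
- by move=> y ys; apply: qq; rewrite inE ys orbT.
rewrite pp ?inE ?eqxx // qq ?inE ?eqxx //.
by rewrite (@eq_in_map _ _ q q' s).1 // => y ys; apply: qq; rewrite inE ys orbT.
Qed.

Lemma eq_in_sweep (X : eqType) Y (p p' : nat -> X -> Y) N s :
  (forall i, {in s, p i =1 p' i}) -> sweep p N [:: s] = sweep p' N [:: s].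
Proof.
move=> pp; elim: N => //= N ->; congr (_ ++ _); rewrite /prismc /= !cats0.
exact: eq_in_prism.
Qed.

Lemma mem_prism (X Y : eqType) (p q : X -> Y) s t :
  t \in prism p q s ->
  forall y, y \in t -> exists2 x, x \in s & y = p x \/ y = q x.
Proof.
elim: s t => //= x s IH t; rewrite inE => /orP[/eqP ->|/mapP[r rs ->]] y.
  rewrite !inE => /or3P[/eqP->|/eqP->|/mapP[z zs ->]].
  - by exists x; [rewrite inE eqxx|left].
  - by exists x; [rewrite inE eqxx|right].
  - by exists z; [rewrite inE zs orbT|right].
rewrite inE => /orP[/eqP->|/(IH _ rs)[z zs]].
  by exists x; [rewrite inE eqxx|left].
by exists z => //; rewrite inE zs orbT.
Qed.

(** A simplex of the sweep lies in a single layer, over a single simplex of [c]; this is what bounds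
    its diameter. *)
Lemma mem_sweep (X Y : eqType) (p : nat -> X -> Y) N c t :
  t \in sweep p N c -> exists2 s, s \in c & exists2 i, (i < N)%N &
  forall y, y \in t -> exists2 x, x \in s & y = p i x \/ y = p i.+1 x.
Proof.
elim: N => //= N IH; rewrite mem_cat => /orP[/IH[s sc [i iN H]]|].
  by exists s => //; exists i => //; rewrite ltnW.
by move=> /flatten_mapP[s sc /mem_prism H]; exists s => //; exists N.
Qed.

End Chains.

(** * Cochains that detect alternating signs *)

Section AlternatingCochains.
Implicit Types (v w : nat -> bool) (s : seq (nat -> bool)).

(* [alt k] is the cup product of the coboundaries of the 0-cochains
   [v |-> v (k-1)], ..., [v |-> v 0]; [palt k] is the cup product of
   [v |-> v k] with [alt k]. *)
Fixpoint alt (k : nat) s : bool :=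
  match k, s with
  | 0, [:: _] => true
  | k'.+1, v :: ((w :: _) as r) => (v k' (+) w k') && alt k' r
  | _, _ => false
  end.

Definition palt (k : nat) s : bool :=
  if s is v :: _ then v k && alt k s else false.

(** A cup product of coboundaries is a cocycle; the Leibniz rule is unfolded on the first
    vertices. *)
Lemma ev_alt_bd k s : ev (alt k) (bd s) = false.
Proof.
elim: k s => [|k IH] [|v [|w r]]; rewrite ?ev_nil //=.
- by rewrite !ev_cons ev_nil.
- rewrite !ev_cons !ev_map.
  under eq_ev do rewrite /=.
  rewrite ev_false; by case: r.
- by rewrite !ev_cons ev_nil.
- have := IH (w :: r); rewrite /= ev_cons ev_map => IHr.
  rewrite !ev_cons !ev_map.
  have -> : ev ((alt k.+1 \o cons v) \o cons w) (bd r) =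
     (v k (+) w k) && ev (alt k \o cons w) (bd r).
    by rewrite -ev_andl; apply: eq_ev => t.
  case: r IHr => [|x r] IHr.
    by rewrite ev_nil andbF.
  move: IHr; move: (ev _ _) (alt k (x :: r)) => a b.
  by case: (v k); case: (w k); case: (x k); case: a; case: b.
Qed.

(** Leibniz rule: since [alt k] is a cocycle, the coboundary of [palt k] only differentiates the
    leading factor, which yields [alt k.+1]. *)
Lemma ev_palt_bd k s : ev (palt k) (bd s) = alt k.+1 s.
Proof.
case: s => [|v [|w r]]; [exact: ev_nil|by rewrite ev_cons ev_nil|].
rewrite /= -/(bd (w :: r)).
have := ev_alt_bd k (v :: w :: r); rewrite [bd _]/= !ev_cons !ev_map => H.
have -> : ev ((palt k \o cons v) \o cons w) (bd r) =
     v k && ev ((alt k \o cons v) \o cons w) (bd r).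
  by rewrite -ev_andl; apply: eq_ev => t.
have : palt k (v :: r) = v k && alt k (v :: r) by [].
move=> ->; rewrite -[palt k _]/(w k && alt k (w :: r)).
move: H; move: (ev _ _) (alt k (w :: r)) (alt k (v :: r)) => a b c.
by case: (v k); case: (w k); case: a; case: b; case: c.
Qed.

(** Negating all labels preserves the differences that make up [alt k] and flips the leading factor
    of [palt k]. *)
Lemma palt_opp k s : palt k s (+) palt k (map (fun v i => ~~ v i) s) = alt k s.
Proof.
have H : alt k (map (fun v i => ~~ v i) s) = alt k s.
  elim: k s => [|k IH] [|v [|w r]] //=.
  by rewrite -[LHS]/(_ && alt k (map _ (w :: r))) IH addbN addNb negbK.
case: s H => [|v r] /=; first by case: k.
by move=> ->; case: (v k) => /=; rewrite ?addbF.
Qed.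

(** Each factor of [alt k] is a label that differs along one edge. For sign labels, this is a
    simplex on which the first [k] functions all change sign. *)
Lemma alt_change (X : eqType) (L : X -> nat -> bool) k (s : seq X) i :
  alt k (map L s) -> (i < k)%N ->
  (exists2 x, x \in s & L x i) /\ (exists2 x, x \in s & ~~ L x i).
Proof.
elim: k s => [|k IH] [|v [|w r]] //= /andP[vw H]; rewrite ltnS leq_eqVlt.
case/orP => [/eqP->|/(IH (w :: r) H)[[x xs xi] [y ys yi]]]; last first.
  by split; [exists x|exists y] => //; rewrite inE (xs, ys) orbT.
case E: (L v k) vw => /=; case F: (L w k) => // _; split.
- by exists v; [rewrite !inE eqxx|rewrite E].
- by exists w; [rewrite !inE eqxx orbT|rewrite F].
- by exists w; [rewrite !inE eqxx orbT|rewrite F].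
- by exists v; [rewrite !inE eqxx|rewrite E].
Qed.

End AlternatingCochains.

Local Open Scope classical_set_scope.
Local Open Scope ring_scope.

(** * Symmetric cycles *)

Section SymmetricChains.
Variables (X : eqType) (T : X -> X) (L : X -> nat -> bool).
Implicit Types (h z : seq (seq X)).

Definition symc h := h ++ map (map T) h.

Lemma mem_symc h s :
  s \in symc h -> exists2 r, r \in h & s = r \/ s = map T r.
Proof.
rewrite mem_cat => /orP[sh|/mapP[r rh ->]]; first by exists s => //; left.
by exists r => //; right.
Qed.

Lemma ev_symc phi h : ev phi (symc h) = ev (fun s => phi s (+) phi (map T s)) h.
Proof. by rewrite ev_cat ev_map ev_add. Qed.

(** A simplex and its image contribute equally and cancel mod 2. *)
Lemma ev_symc_even (phi : seq X -> bool) h :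
  (forall s, s \in h -> phi (map T s) = phi s) -> ev phi (symc h) = false.
Proof.
move=> H; rewrite ev_symc -[RHS](ev_false h); apply: eq_in_ev => s sh.
by rewrite H // addbb.
Qed.

(** By [palt_opp], a simplex and its image under an odd labelling contribute [alt k] together; the
    value on a symmetric chain is thus read off from one half. *)
Lemma ev_symc_palt k h :
  (forall s v, s \in h -> v \in s -> L (T v) = fun i => ~~ L v i) ->
  ev (palt k \o map L) (symc h) = ev (alt k \o map L) h.
Proof.
move=> H; rewrite ev_symc; apply: eq_in_ev => s sh /=.
rewrite -palt_opp; congr (_ (+) palt k _); rewrite -!map_comp.
by apply/eq_in_map => v vs /=; rewrite (H s).
Qed.

(** Stokes formula for [alt k.+1] as the coboundary of [palt k]. *)
Lemma ev_alt_bdc k h :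
  ev (alt k.+1 \o map L) h = ev (palt k \o map L) (bdc h).
Proof.
rewrite ev_bdc; apply: eq_ev => s.
by rewrite -[LHS]/(alt k.+1 (map L s)) -ev_palt_bd bd_map ev_map.
Qed.

Lemma sweep_cycle (p : nat -> X -> X) N z phi :
  (forall psi, ev psi (bdc z) = false) ->
  (forall s v, s \in z -> v \in s -> p 0 v = v) ->
  ev phi (bdc (sweep p N z)) = ev phi (map (map (p N)) z) (+) ev phi z.
Proof.
move=> cz p0; rewrite ev_bd_sweep ev_sweep cz addbF; congr (_ (+) _).
congr ev; rewrite -[RHS]map_id; apply/eq_in_map => s sz.
by rewrite -[RHS]map_id; apply/eq_in_map => v vs; exact: p0 vs.
Qed.

(** One suspension. The value of [palt k.+1] on the symmetrized sweep is that of [alt k.+1] on the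
    sweep, hence that of [palt k] on its boundary; the far end contributes 0 and [z] contributes
    1. *)
Lemma palt_step k (p : nat -> X -> X) N z :
  (forall psi, ev psi (bdc z) = false) ->
  (forall s v, s \in z -> v \in s -> p 0 v = v) ->
  ev (palt k \o map L) (map (map (p N)) z) = false ->
  (forall s v, s \in sweep p N z -> v \in s -> L (T v) = fun i => ~~ L v i) ->
  ev (palt k \o map L) z ->
  ev (palt k.+1 \o map L) (symc (sweep p N z)).
Proof.
move=> cz p0 pN odd pz.
by rewrite ev_symc_palt // ev_alt_bdc sweep_cycle // pN pz.
Qed.

End SymmetricChains.

(** * Sign labels of a family of real functions *)

Section SignLabels.
Variables (R : realType) (n : nat) (X : Type) (f : 'I_n.+1 -> X -> R).

(* Ties are broken by the sign of the first nonzero component, which keeps the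
   labels equivariant. *)
Definition sign_tie (x : X) : bool :=
  if [pick j | f j x != 0] is Some j then 0 < f j x else false.

Definition sign_label (x : X) (i : nat) : bool :=
  if f (inord i) x == 0 then sign_tie x else 0 < f (inord i) x.

Lemma sign_label_eq x y :
  (forall j, f j y = f j x) -> sign_label y = sign_label x.
Proof.
move=> H; apply/funext => i; rewrite /sign_label /sign_tie !H.
have -> : [pick j | f j y != 0] = [pick j | f j x != 0].
  by apply: eq_pick => j; rewrite H.
by case: pickP => // j _; rewrite H.
Qed.

(** A nonzero component is required: it supplies the tie-breaking sign, which then changes along
    with all other signs. *)
Lemma sign_label_opp x y : (forall j, f j y = - f j x) ->
  (exists j, f j x != 0) -> sign_label y = fun i => ~~ sign_label x i.
Proof.
move=> H [j0 fj0]; apply/funext => i; rewrite /sign_label /sign_tie.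
have oppE j : f j x != 0 -> (0 < f j y) = ~~ (0 < f j x).
  by move=> fj; rewrite H oppr_gt0 -leNgt lt_neqAle fj.
have -> : [pick j | f j y != 0] = [pick j | f j x != 0].
  by apply: eq_pick => j; rewrite /= H oppr_eq0.
rewrite H oppr_eq0; case: ifPn => [_|fi]; last by rewrite -H oppE.
by case: pickP => [j /oppE //|/(_ j0)]; rewrite fj0.
Qed.

Lemma sign_label_ge0 x i : sign_label x i -> 0 <= f (inord i) x.
Proof. by rewrite /sign_label; case: eqP => [->//|_ /ltW]. Qed.

Lemma sign_label_le0 x i : ~~ sign_label x i -> f (inord i) x <= 0.
Proof. by rewrite /sign_label; case: eqP => [->//|_]; rewrite -leNgt. Qed.

End SignLabels.

(** The points (sqrt(1 - i/N), sqrt(i/N)) lie exactly on the circle. The sequence [s] alone also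
    serves as a fine subdivision of [0, 1]. *)
Lemma quarter_circle_path (R : realType) (e : R) : 0 < e ->
  exists N (c s : nat -> R),
  [/\ c 0 = 1, s 0 = 0, c N = 0 & s N = 1] /\
  forall i, (i <= N)%N -> [/\ c i ^+ 2 + s i ^+ 2 = 1, 0 <= c i <= 1,
    0 <= s i <= 1 &
    forall j, (j <= N)%N -> (i <= j.+1)%N -> (j <= i.+1)%N ->
    `|c i - c j| <= e /\ `|s i - s j| <= e].
Proof.
move=> e0.
(* For x, y >= 0, (x - y)^2 <= |x - y| (x + y) = |x^2 - y^2|; hence steps of size [e ^+ 2] in the
   radicand suffice. *)
have sqrt_close (a b : R) : 0 <= a -> 0 <= b -> `|a - b| <= e ^+ 2 ->
    `|Num.sqrt a - Num.sqrt b| <= e.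
  move=> a0 b0 ab; rewrite -ler_sqr ?nnegrE ?normr_ge0 ?(ltW e0) //.
  apply: le_trans ab; have := sqrtr_ge0 a; have := sqrtr_ge0 b.
  rewrite -{3}(sqr_sqrtr a0) -{3}(sqr_sqrtr b0).
  move: (Num.sqrt a) (Num.sqrt b) => x y y0 x0.
  rewrite subr_sqr normrM expr2 ler_wpM2l //.
  by rewrite (ger0_norm (addr_ge0 x0 y0)) ler_norml; lra.
pose N := (Num.bound (e^-1 ^+ 2)).+1.
have HN : N%:R^-1 <= e ^+ 2.
  rewrite invf_ple ?posrE ?exprn_gt0 ?ltr0n //.
  rewrite -exprVn (le_trans (ltW (archi_boundP _))) ?exprn_ge0 ?invr_ge0 ?(ltW e0) //.
  by rewrite ler_nat leqnSn.
pose t i : R := i%:R / N%:R.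
have N0 : N%:R != 0 :> R by rewrite pnatr_eq0.
exists N, (fun i => Num.sqrt (1 - t i)), (fun i => Num.sqrt (t i)); split.
  by rewrite /t mul0r subr0 sqrtr1 sqrtr0 divff // subrr sqrtr0 sqrtr1.
have t01 i : (i <= N)%N -> 0 <= t i <= 1.
  by move=> iN; rewrite /t divr_ge0 //= ler_pdivrMr ?ltr0n // mul1r ler_nat.
have s01 (x : R) : 0 <= x <= 1 -> 0 <= Num.sqrt x <= 1.
  by move=> /andP[x0 x1]; rewrite sqrtr_ge0 -sqrtr1 ler_wsqrtr.
move=> i iN; have /andP[i0 i1] := t01 i iN.
split; [|by apply: s01; lra|by apply: s01; lra|].
  by rewrite !sqr_sqrtr ?subr_ge0 //; lra.
move=> j jN ij ji; have /andP[j0 j1] := t01 j jN.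
have tij : `|t i - t j| <= e ^+ 2.
  rewrite (le_trans _ HN) // /t -mulrBl normrM [X in _ * X]ger0_norm ?invr_ge0 //.
  rewrite ler_piMl ?invr_ge0 // ler_norml.
  have : i%:R <= j.+1%:R :> R by rewrite ler_nat.
  have : j%:R <= i.+1%:R :> R by rewrite ler_nat.
  by rewrite -!natr1; lra.
split; apply: sqrt_close; rewrite ?subr_ge0 //.
have -> : 1 - t i - (1 - t j) = t j - t i by lra.
by rewrite distrC.
Qed.

(** * Fine symmetric chains in the cylinder over the sphere of directions *)

Section CommonZero.
Variables (R : realType) (n : nat).
Let X : eqType := ('rV[R]_n.+2 * R * R)%type.
Implicit Types (u : 'rV[R]_n.+2) (v w : X) (s : seq X) (h z : seq (seq X)).

(** Reversing the horizontal axis of the plane: the direction and the horizontal parameter change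
    sign, the vertical parameter stays. *)
Definition antipode v : X := (- v.1.1, - v.1.2, v.2).

Definition near_pts (e : R) v w : Prop :=
  [/\ forall i, `|v.1.1 ord0 i - w.1.1 ord0 i| <= e,
      `|v.1.2 - w.1.2| <= e & `|v.2 - w.2| <= e].

Definition mesh (e : R) (P : X -> Prop) z :=
  forall s, s \in z -> forall v w, v \in s -> w \in s -> P v /\ near_pts e v w.

(** Two vertices of a swept simplex come from one simplex of [z], at times that differ by at most
    one. *)
Lemma mesh_sweep e e' (P P' : X -> Prop) (p : nat -> X -> X) N z :
  mesh e P z ->
  (forall i v, (i <= N)%N -> P v -> P' (p i v)) ->
  (forall i j v w, P v -> P w -> near_pts e v w -> (i <= N)%N -> (j <= N)%N ->
     (i <= j.+1)%N -> (j <= i.+1)%N -> near_pts e' (p i v) (p j w)) ->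
  mesh e' P' (sweep p N z).
Proof.
move=> mz pP near_p s /mem_sweep[r rz [i iN H]] v w /H[x xr vx] /H[y yr wy].
have [Px nxy] := mz r rz x y xr yr; have [Py _] := mz r rz y x yr xr.
have iN' := ltnW iN.
by case: vx => ->; case: wy => ->; (split; [exact: pP|apply: near_p]);
  rewrite ?(leqnSn, leqnn) // ?(leqW (leqnSn _)).
Qed.

Lemma mesh_symc e (P : X -> Prop) h : (forall v, P v -> P (antipode v)) ->
  mesh e P h -> mesh e P (symc antipode h).
Proof.
move=> PT mh s /mem_symc[r /mh mr [->//|->]] _ _ /mapP[v vr ->] /mapP[w wr ->].
have [/PT Pv [nvw1 nvw2 nvw3]] := mr v w vr wr; split => //; split => //=.
- by move=> i; rewrite !mxE -opprD normrN.
- by rewrite -opprD normrN.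
Qed.

Lemma map_antipodeK z : map (map antipode) (map (map antipode) z) = z.
Proof.
rewrite -map_comp -[RHS]map_id; apply: eq_map => s /=.
rewrite -map_comp -[RHS]map_id; apply: eq_map => -[[u a] b] /=.
by rewrite /antipode /= !opprK.
Qed.

Lemma ev_symc_antipode phi h :
  ev phi (map (map antipode) (symc antipode h)) = ev phi (symc antipode h).
Proof. by rewrite map_cat map_antipodeK !ev_cat addbC. Qed.

(** The sphere S^k in the first k + 1 coordinates; for [k = n] it is the sphere of horizontal
    directions. *)
Definition on_sphere k u :=
  \sum_i u ord0 i ^+ 2 = 1 /\ forall i : 'I_n.+2, (k < i)%N -> u ord0 i = 0.

Lemma on_sphereN k u : on_sphere k u -> on_sphere k (- u).
Proof.
move=> [u1 uk]; split => [|i /uk]; last by rewrite mxE => ->; rewrite oppr0.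
by rewrite -[RHS]u1; apply: eq_bigr => i _; rewrite mxE sqrrN.
Qed.

Lemma on_sphere_le1 k u i : on_sphere k u -> `|u ord0 i| <= 1.
Proof.
move=> [u1 _]; rewrite -(@ler_pXn2r _ 2) ?nnegrE ?normr_ge0 ?ler01 //.
rewrite expr1n real_normK ?num_real // -u1 (bigD1 i) //= lerDl sumr_ge0 // => j _.
exact: sqr_ge0.
Qed.

Lemma on_sphere_horizontal u : on_sphere n u <-> horizontal_unit u.
Proof.
split=> -[H1 H2]; split => //.
- by move=> i /= in1; apply: H2; rewrite in1.
- move=> i ni; apply: H1; apply/eqP; rewrite eqn_leq.
  by rewrite -ltnS ltn_ord.
Qed.

(** For (c, s) on the unit circle, a point of the meridian from [u] to the pole on the next
    coordinate axis. *)
Definition rotate k (c s : R) u : 'rV[R]_n.+2 :=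
  c *: u + s *: delta_mx ord0 (inord k.+1).

Lemma on_sphere_rotate k (c s : R) u : (k < n)%N -> c ^+ 2 + s ^+ 2 = 1 ->
  on_sphere k u -> on_sphere k.+1 (rotate k c s u).
Proof.
move=> kn cs [u1 uk].
have kE : (inord k.+1 : 'I_n.+2) = k.+1 :> nat by rewrite inordK // ltnS ltnW.
split => [|i ki]; last first.
  rewrite !mxE uk ?(ltn_trans _ ki) // mulr0 add0r /= -val_eqE /= kE.
  by rewrite gtn_eqF // mulr0.
rewrite (bigD1 (inord k.+1)) //= !mxE uk ?kE // !eqxx mulr0 add0r mulr1.
rewrite -cs addrC; congr (_ + _); rewrite -[RHS]mulr1 -u1.
rewrite [X in _ = _ * X](bigD1 (inord k.+1)) //= uk ?kE // expr0n add0r mulr_sumr.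
by apply: eq_bigr => i /negbTE ik; rewrite !mxE eqxx ik mulr0 addr0 exprMn.
Qed.

(** The increments of [u], [c] and [s] are bounded by [e] each, whence the factor 3. *)
Lemma rotate_near e k (c s c' s' : R) u u' :
  0 <= c <= 1 -> `|c - c'| <= e -> `|s - s'| <= e ->
  (forall i, `|u ord0 i - u' ord0 i| <= e) ->
  (forall i, `|u' ord0 i| <= 1) ->
  forall i, `|rotate k c s u ord0 i - rotate k c' s' u' ord0 i| <= e *+ 3.
Proof.
move=> /andP[c0 c1] cc ss uu u1 i; rewrite !mxE eqxx /=.
set d := (i == _)%:R.
have -> : c * u ord0 i + s * d - (c' * u' ord0 i + s' * d) =
  c * (u ord0 i - u' ord0 i) + (c - c') * u' ord0 i + (s - s') * d by ring.
have e0 : 0 <= e := le_trans (normr_ge0 _) cc.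
have d1 : `|d| <= 1 by rewrite /d; case: (_ == _); rewrite ?normr1 ?normr0.
rewrite mulrSr mulr2n; apply: (le_trans (ler_normD _ _)); apply: lerD.
  apply: (le_trans (ler_normD _ _)); apply: lerD; rewrite normrM.
    rewrite -[e]mul1r; apply: ler_pM => //; first by rewrite ger0_norm.
  by rewrite -[e]mulr1; apply: ler_pM.
by rewrite normrM -[e]mulr1; apply: ler_pM.
Qed.

Lemma near_ptsxx e v : 0 <= e -> near_pts e v v.
Proof. by move=> e0; split => [i||]; rewrite subrr normr0. Qed.

Lemma on_sphereW k m u : (k <= m)%N -> on_sphere k u -> on_sphere m u.
Proof. by move=> km [u1 uk]; split => // i /(leq_ltn_trans km); exact: uk. Qed.

Let equator k v := [/\ on_sphere k v.1.1, v.1.2 = 0 & v.2 = -1].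

(** The starting cycle is symmetric, so its two copies cancel and only the far end and its antipodal
    image remain. *)
Lemma bdc_symc_sweep (p : nat -> X -> X) N h psi :
  let z := symc antipode h in
  (forall psi, ev psi (bdc z) = false) ->
  (forall s v, s \in z -> v \in s -> p 0 v = v) ->
  ev psi (bdc (symc antipode (sweep p N z))) =
  ev psi (map (map (p N)) z) (+)
  ev (psi \o map antipode) (map (map (p N)) z).
Proof.
move=> z cz p0.
rewrite /symc /bdc map_cat flatten_cat -!/(bdc _) ev_cat bdc_map ev_map.
rewrite !sweep_cycle // -[ev (psi \o _) z]ev_map (ev_symc_antipode psi h).
by rewrite addbACA addbb addbF.
Qed.

(** * Nonvanishing of the cochains for an equivariant labelling *)

Section Labelled.
Variable L : X -> nat -> bool.
Hypothesis L_odd : forall v, on_sphere n v.1.1 -> -1 <= v.1.2 <= 1 ->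
  v.2 = -1 -> L (antipode v) = fun i => ~~ L v i.

Lemma sphere_chain k (e : R) : (k <= n)%N -> 0 < e -> exists h,
  let z := symc antipode h in
  [/\ forall psi, ev psi (bdc z) = false, ev (palt k \o map L) z &
      mesh e (equator k) z].
Proof.
elim: k e => [|k IH] e kn e0.
  (* [v0] and its antipode form S^0; their labels are opposite, so [palt 0] is 1 on the pair. *)
  pose v0 : X := (delta_mx ord0 ord0, 0, -1).
  have v0E : equator 0 v0.
    split => //; split => [|i i0] /=; last first.
      by rewrite mxE eqxx -val_eqE /= gtn_eqF.
    rewrite (bigD1 ord0) //= mxE !eqxx expr1n big1 ?addr0 // => i /negbTE i0.
    by rewrite mxE i0 andbF expr0n.
  have aE v : equator 0 v -> equator 0 (antipode v).
    by case: v => [[u a] b] [/= /on_sphereN ? -> ->]; split => //=; rewrite oppr0.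
  exists [:: [:: v0]]; split => [psi||].
  - by rewrite /symc /bdc /= !ev_cons !ev_nil addbF addbb.
  - rewrite ev_symc_palt => [|s v]; first by rewrite ev_cons ev_nil.
    rewrite inE => /eqP ->; rewrite inE => /eqP ->; apply: L_odd => //=.
      by case: v0E => /(on_sphereW (leq0n n)).
    by rewrite lerN10 ler01.
  - apply: mesh_symc => // s; rewrite inE => /eqP -> v w.
    rewrite !inE => /eqP -> /eqP ->; split => //.
    exact/near_ptsxx/ltW.
have e3 : 0 < e / 3 by rewrite divr_gt0.
have [h [cz pz mz]] := IH _ (ltnW kn) e3.
have [N [c [s [[c0 s0 cN sN] cs]]]] := quarter_circle_path e3.
pose p i v : X := (rotate k (c i) (s i) v.1.1, v.1.2, v.2).
have p0 t v : t \in symc antipode h -> v \in t -> p 0 v = v.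
  by move=> _ _; rewrite /p /rotate c0 s0 scale1r scale0r addr0 -!surjective_pairing.
have mh' : mesh e (equator k.+1) (sweep p N (symc antipode h)).
  apply: mesh_sweep mz _ _.
    move=> i [[u a] b] iN [/= uk -> ->]; split => //=.
    by apply: on_sphere_rotate => //; have [] := cs i iN.
  move=> i j [[u a] b] [[u' a'] b'] [/= uk -> ->] [/= uk' -> ->] [/= nu _ _].
  move=> iN jN ij ji; have [_ ci _ /(_ j jN ij ji)[cij sij]] := cs i iN.
  split => /=; rewrite ?subrr ?normr0 ?(ltW e0) // => l.
  have -> : e = (e / 3) *+ 3 by rewrite -mulr_natr divfK.
  by apply: rotate_near => // l'; apply: on_sphere_le1 uk'.
(* At the far end everything collapses to the pole, so antipodal simplices have equal images and
   cancel. *)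
have pN (phi : seq X -> bool) : ev phi (map (map (p N)) (symc antipode h)) = false.
  rewrite ev_map; apply: ev_symc_even => t th /=; congr phi.
  rewrite -map_comp; apply/eq_in_map => -[[u a] b] vt /=.
  have [] := mz t _ _ _ vt vt; first by rewrite mem_cat th.
  by case=> /= _ -> _ _; rewrite /p /rotate cN /= !scale0r oppr0.
exists (sweep p N (symc antipode h)); split.
- by move=> psi; rewrite bdc_symc_sweep // !pN.
- apply: palt_step => // t v /mh' mt vt; have [[vk v1 v2] _] := mt _ _ vt vt.
  apply: L_odd => //; first exact: on_sphereW vk.
  by rewrite v1 lerN10 ler01.
- apply: mesh_symc mh' => -[[u a] b] [/= uk -> ->].
  by split; rewrite /= ?oppr0 //; exact: on_sphereN.
Qed.

Hypothesis L_side : forall u (a b : R), on_sphere n u -> a = 1 \/ a = -1 ->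
  L (- u, a, b) = L (u, a, b).
Hypothesis L_top : forall u (a : R), on_sphere n u -> -1 <= a <= 1 ->
  L (- u, - a, 1) = L (u, a, 1).

Let box v := [/\ on_sphere n v.1.1, -1 <= v.1.2 <= 1 & -1 <= v.2 <= 1].

(** Two more sweeps extend the sphere: over the horizontal parameter to a symmetric chain with
    [palt n.+1] equal to 1, then over the vertical parameter. On the result [alt n.+2] takes the
    value 1, hence is true on some simplex. *)
Lemma alternating_small_simplex (e : R) : 0 < e -> exists s : seq X,
  alt n.+2 (map L s) /\
  forall v w, v \in s -> w \in s -> box v /\ near_pts e v w.
Proof.
move=> e0.
(* Each of the two sweeps is allowed to triple the mesh. *)
have e9 : 0 < e / 9 by rewrite divr_gt0.
have [h [cz pz mz]] := sphere_chain (leqnn n) e9.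
have [N [c [s [[_ s0 _ sN] cs]]]] := quarter_circle_path e9.
(* Only the half from 0 to 1 is swept; symmetrization adds the half from 0 to -1. *)
pose p i v : X := (v.1.1, s i, v.2).
have hz t v : t \in symc antipode h -> v \in t -> equator n v.
  by move=> tz vt; have [] := mz t tz _ _ vt vt.
have p0 t v : t \in symc antipode h -> v \in t -> p 0 v = v.
  move=> /hz H /H; case: v {H} => [[u a] b] [/= _ -> _].
  by rewrite /p s0.
pose z1 := symc antipode (sweep p N (symc antipode h)).
pose slab v := [/\ on_sphere n v.1.1, -1 <= v.1.2 <= 1 & v.2 = -1].
have mh1 : mesh (e / 3) slab (sweep p N (symc antipode h)).
  apply: mesh_sweep mz _ _.
    move=> i [[u a] b] iN [/= uk _ ->]; split => //=.
    by have [_ _ /andP[si0 si1] _] := cs i iN; apply/andP; split; lra.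
  move=> i j [[u a] b] [[u' a'] b'] [/= uk _ ->] [/= uk' _ ->] [/= nu _ _].
  move=> iN jN ij ji; have [_ _ _ /(_ j jN ij ji)[_ sij]] := cs i iN.
  split => /= [l||]; last by rewrite subrr normr0 divr_ge0 // ltW.
  - by have := nu l; lra.
  - by lra.
have mz1 : mesh (e / 3) slab z1.
  apply: mesh_symc mh1 => -[[u a] b] [/= uk a1 ->].
  by split => //=; [exact: on_sphereN|move: a1 => /andP[? ?]; apply/andP; split; lra].
(* At the end [a = 1], [L_side] gives antipodal simplices of the sphere equal labels. *)
have pN : ev (palt n \o map L) (map (map (p N)) (symc antipode h)) = false.
  rewrite ev_map; apply: ev_symc_even => t th /=; congr palt.
  rewrite -!map_comp; apply/eq_in_map => v vt /=.
  rewrite /p /= sN L_side //; last by left.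
  by have [] := hz t v _ vt; rewrite ?mem_cat ?th.
have pz1 : ev (palt n.+1 \o map L) z1.
  apply: palt_step => // t v /mh1 mt vt; have [[vk v1 v2] _] := mt _ _ vt vt.
  exact: L_odd.
(* The map 2s - 1 carries the subdivision of [0, 1] to [-1, 1]. *)
pose q i v : X := (v.1, 2 * s i - 1).
have q0 t v : t \in z1 -> v \in t -> q 0 v = v.
  move=> tz vt; have [[_ _ v2] _] := mz1 _ tz _ _ vt vt.
  by rewrite /q s0 mulr0 sub0r -v2 -surjective_pairing.
have mQ : mesh e box (sweep q N z1).
  apply: mesh_sweep mz1 _ _.
    move=> i [[u a] b] iN [/= uk a1 _]; split => //=.
    by have [_ _ /andP[si0 si1] _] := cs i iN; apply/andP; split; lra.
  move=> i j [[u a] b] [[u' a'] b'] _ _ [/= nu na _].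
  move=> iN jN ij ji; have [_ _ _ /(_ j jN ij ji)[_ sij]] := cs i iN.
  split => /= [l||]; first by have := nu l; lra.
  - by lra.
  - have -> : 2 * s i - 1 - (2 * s j - 1) = 2 * (s i - s j) by ring.
    by rewrite normrM ger0_norm //; lra.
have : ev (alt n.+2 \o map L) (sweep q N z1).
  rewrite ev_alt_bdc ev_bd_sweep.
  (* The top face cancels by [L_top]. *)
  have -> : ev (palt n.+1 \o map L) (map (map (q N)) z1) = false.
    rewrite ev_map; apply: ev_symc_even => t th /=; congr palt.
    rewrite -!map_comp; apply/eq_in_map => v vt /=.
    have [[vk v1 _] _] := mh1 _ th _ _ vt vt.
    have -> : q N v = (v.1.1, v.1.2, 1).
      rewrite /q sN -surjective_pairing; congr (_, _); lra.
    have -> : q N (antipode v) = (- v.1.1, - v.1.2, 1).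
      rewrite /q sN; congr (_, _); lra.
    exact: L_top.
  have -> : map (map (q 0%N)) z1 = z1.
    rewrite -[RHS]map_id; apply/eq_in_map => t tz.
    by rewrite -[RHS]map_id; apply/eq_in_map => v vt; exact: q0 vt.
  (* The bottom face gives 1. The side wall is the value on [bdc z1] of the cochain [psi], which
     sweeps and then evaluates; it splits into the walls [a = 1] and [a = -1], and each cancels by
     [L_side]. *)
  rewrite pz1 ev_sweep bdc_symc_sweep //.
  set psi := fun t : seq X => _.
  have psi_map (g : X -> X) t :
      psi (map g t) = ev (palt n.+1) (sweep (fun i => L \o (q i \o g)) N [:: t]).
    rewrite /psi -[[:: map g t]]/(map (map g) [:: t]) sweep_map.
    by rewrite -[LHS]ev_map map_sweep.
  rewrite !ev_map !ev_symc_even // => t th /=; rewrite -!map_comp !psi_map.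
    congr ev; apply: eq_in_sweep => i v vt /=.
    rewrite /q /p /antipode /= !opprK sN -[in RHS]L_side ?opprK //; last by right.
    by apply: on_sphereN; have [] := hz t v _ vt; rewrite ?mem_cat ?th.
  congr ev; apply: eq_in_sweep => i v vt /=.
  rewrite /q /p /antipode /= sN L_side //; last by left.
  by have [] := hz t v _ vt; rewrite ?mem_cat ?th.
move=> evQ.
have [/hasP[t tQ at_]|nQ] := boolP (has (alt n.+2 \o map L) (sweep q N z1)).
  by exists t; split => //; exact: mQ.
move: evQ; rewrite (@eq_in_ev _ _ (fun=> false)) ?ev_false // => t tQ.
by apply/negbTE; apply: contra nQ => at_; apply/hasP; exists t.
Qed.

End Labelled.

End CommonZero.

(** * Compactness argument *)

Lemma near_pts_ball (R : realType) n (e r : R) (v w : 'rV[R]_n.+2 * R * R) :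
  e < r -> near_pts e v w -> ball v r w.
Proof.
move=> er [nu na nb]; split; [split|]; last exact: le_lt_trans er.
  split; first exact: le_lt_trans (le_trans (normr_ge0 _) na) er.
  by move=> i j; rewrite (ord1 i); exact: le_lt_trans (nu j) er.
exact: le_lt_trans er.
Qed.

Lemma horizontal_unit_compact (R : realType) n :
  compact [set u : 'rV[R]_n.+2 | horizontal_unit u].
Proof.
apply: bounded_closed_compact.
  exists 1; split; first exact: num_real.
  move=> M M1 u /on_sphere_horizontal uS; apply: le_trans (ltW M1).
  rewrite -[`|u|]/(mx_norm u) mx_normrE; apply: bigmax_le => // -[i j] _ /=.
  by rewrite (ord1 i); exact: on_sphere_le1 uS.
have -> : [set u : 'rV[R]_n.+2 | horizontal_unit u] =
  [set u : 'rV[R]_n.+2 | u ord0 ord_max = 0] `&`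
  (fun u : 'rV[R]_n.+2 => \sum_(i < n.+2) u ord0 i ^+ 2) @^-1` [set x | x = 1].
  apply/seteqP; split => u [H1 H2]; split => //=; first exact: H1.
  by move=> i in1; rewrite -H1; congr (u _ _); apply/val_inj.
apply: closedI.
  apply: (@preimage_closed _ _ (fun u : 'rV[R]_n.+2 => u ord0 ord_max) [set x | x = 0]).
    by move=> u _; exact: coord_continuous.
  exact: closed_eq.
apply: preimage_closed; last exact: closed_eq.
move=> u _; move: u; apply: continuous_big.
  by move=> x; exact: add_continuous.
move=> i _ u; apply: (@continuous_comp _ _ _ (fun u : 'rV[R]_n.+2 => u ord0 i) (fun x => x ^+ 2)).
  exact: coord_continuous.
exact: exprn_continuous.
Qed.

Section CommonZeroTheorem.
Variables (R : realType) (n : nat) (f : 'I_n.+2 -> 'rV[R]_n.+2 * R * R -> R).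

Definition cylinder : set ('rV[R]_n.+2 * R * R) :=
  ([set u | horizontal_unit u] `*` `[-1, 1]) `*` `[-1, 1].

Hypothesis f_cont : forall j, {within cylinder, continuous (f j)}.
Hypothesis f_odd : forall j u a, horizontal_unit u -> -1 <= a <= 1 ->
  f j (- u, - a, -1) = - f j (u, a, -1).
Hypothesis f_side : forall j u a b, horizontal_unit u -> a = 1 \/ a = -1 ->
  f j (- u, a, b) = f j (u, a, b).
Hypothesis f_top : forall j u a, horizontal_unit u -> -1 <= a <= 1 ->
  f j (- u, - a, 1) = f j (u, a, 1).

Lemma cylinder_compact : compact cylinder.
Proof.
apply: compact_setX; last exact: segment_compact.
by apply: compact_setX; [exact: horizontal_unit_compact|exact: segment_compact].
Qed.

(** The absence of a zero makes the sign labels odd on the bottom face. Any vertex of the resulting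
    small alternating simplex serves as [v]. *)
Lemma approximate_zero : (forall v, cylinder v -> exists j, f j v != 0) ->
  forall e, 0 < e -> exists v, cylinder v /\ forall j,
  (exists w, [/\ cylinder w, near_pts e v w & 0 <= f j w]) /\
  (exists w, [/\ cylinder w, near_pts e v w & f j w <= 0]).
Proof.
move=> nz e e0.
have cylE (v : 'rV[R]_n.+2 * R * R) : on_sphere n v.1.1 -> -1 <= v.1.2 <= 1 ->
    -1 <= v.2 <= 1 -> cylinder v.
  by move=> /on_sphere_horizontal; do !split => //=; rewrite in_itv.
have := @alternating_small_simplex R n (sign_label f) _ _ _ e e0.
case.
- case=> [[u a] b] /= uS a1 b1; apply: sign_label_opp => [j|].
    by rewrite b1 f_odd //; exact/on_sphere_horizontal.
  apply: nz; apply: cylE => //=; rewrite b1; apply/andP; split; lra.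
- move=> u a b uS a1; apply: sign_label_eq => j.
  by apply: f_side => //; exact/on_sphere_horizontal.
- move=> u a uS a1; apply: sign_label_eq => j.
  by apply: f_top => //; exact/on_sphere_horizontal.
move=> s [alts Hs].
have sP v : v \in s -> cylinder v by move=> vs; have [[? ? ?] _] := Hs v v vs vs; exact: cylE.
case: s alts Hs sP => // v0 s alts Hs sP.
have v0s : v0 \in v0 :: s by rewrite inE eqxx.
exists v0; split=> [|j]; first exact: sP.
 have [[v vs vj] [w ws wj]] := alt_change alts (ltn_ord j).
split.
- exists v; split; [exact: sP|by have [] := Hs _ _ v0s vs|].
  by have := sign_label_ge0 vj; rewrite inord_val.
- exists w; split; [exact: sP|by have [] := Hs _ _ v0s ws|].
  by have := sign_label_le0 wj; rewrite inord_val.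
Qed.

(** If there is no zero, approximate zeros with tolerance 1/(m+1) cluster at some [x]. A component
    that is nonzero at [x] keeps its sign nearby, which contradicts its sign changes. *)
Theorem common_zero : exists2 v, cylinder v & forall j, f j v = 0.
Proof.
apply: contrapT => nzero.
have nz v : cylinder v -> exists j, f j v != 0.
  move=> Kv; apply: contrapT => H; apply: nzero; exists v => // j.
  by apply/eqP; apply: contrapT => fj; apply: H; exists j; apply/negP.
have approx (m : nat) := approximate_zero nz
  (e := m.+1%:R^-1) ltac:(by rewrite invr_gt0).
have [v Hv] := choice approx.
have Kv : (v @ \oo) cylinder by exists 0 => // m _; exact: (Hv m).1.
have [x [Kx clx]] := cylinder_compact (fmap_proper_filter v _) Kv.
have [j fj] := nz x Kx.
have := @f_cont j; rewrite subspace_continuousP => /(_ x Kx)/cvgrPdist_lt.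
(* The tolerance [|f j x|] is small enough for nearby values to keep the sign of [f j x]. *)
have fj0 : 0 < `|f j x| by rewrite normr_gt0.
move=> /(_ _ fj0); rewrite near_withinE => /nbhs_ballP[r /= r0 Hr].
(* Half of [r] is reserved for the distance from [x] to [v m], half for that from [v m] to the
   witnesses of the sign change. *)
have [M _ HM] := near_infty_natSinv_lt (PosNum (divr_gt0 r0 (ltr0Sn R 1))).
have [||y [[m /= Mm ->] xm]] :=
  clx [set y | exists2 m, (M <= m)%N & y = v m] _ _ (nbhsx_ballx x (r / 2) _).
- by exists M => // m /= Mm; exists m.
- by rewrite divr_gt0.
have close w : cylinder w -> near_pts m.+1%:R^-1 (v m) w -> `|f j x - f j w| < `|f j x|.
  move=> Kw /(near_pts_ball (HM m Mm)) mw; apply: Hr => //.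
  by apply: ball_split mw.
have [_ /(_ j)[[w [Kw nw fw]] [w' [Kw' nw' fw']]]] := Hv m.
have := close _ Kw nw; have := close _ Kw' nw'.
have [f0|f0] := ltP (f j x) 0.
  by rewrite (ltr0_norm f0) !ltr_norml; lra.
by rewrite (ger0_norm f0) !ltr_norml; lra.
Qed.

End CommonZeroTheorem.

(** * Continuity of the mass of a wedge *)

Section Squash.
Variable R : realType.
Implicit Types (x y a c : R).

(** An increasing homeomorphism of the line onto (-1, 1), which turns infinite corner coordinates
    into the parameters -1 and 1. *)
Definition squash x := x / (1 + `|x|).

Lemma squash_den_gt0 x : 0 < 1 + `|x|.
Proof. by rewrite ltr_pwDl. Qed.

Lemma squash_continuous : continuous squash.
Proof.
move=> x; apply: cvgM; first exact: cvg_id.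
apply: cvgV; first by rewrite gt_eqF // squash_den_gt0.
apply: cvgD; first exact: cvg_cst.
by apply: cvg_norm; exact: cvg_id.
Qed.

Lemma squashN x : squash (- x) = - squash x.
Proof. by rewrite /squash normrN mulNr. Qed.

Lemma squash_gtN1 x : -1 < squash x.
Proof.
rewrite /squash ltr_pdivlMr ?squash_den_gt0 // mulN1r.
by have := ler_norm (- x); rewrite normrN; lra.
Qed.

Lemma squash_lt1 x : squash x < 1.
Proof. by have := squash_gtN1 (- x); rewrite squashN; lra. Qed.

Lemma squash_increasing : {mono squash : x y / x <= y}.
Proof.
apply: le_mono => x y xy; rewrite /squash.
rewrite ltr_pdivrMr ?squash_den_gt0 // mulrAC ltr_pdivlMr ?squash_den_gt0 //.
have [x0|x0] := ler0P x; have [y0|y0] := ler0P y; try by lra.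
(* For x <= 0 < y the products do not cancel after clearing denominators, and the sign of x y
   decides. *)
by have := mulr_le0_ge0 x0 (ltW y0); lra.
Qed.

Lemma squash_inv a : -1 < a < 1 -> squash (a / (1 - `|a|)) = a.
Proof.
move=> /andP[a1 a2]; have a0 : 0 < 1 - `|a| by rewrite subr_gt0 ltr_norml a1.
rewrite /squash normrM normfV (gtr0_norm a0).
have -> : 1 + `|a| / (1 - `|a|) = (1 - `|a|)^-1.
  by field; rewrite gt_eqF.
by rewrite invrK divfK // gt_eqF.
Qed.

(* Continuous approximation of the indicator of [{x | c <= squash x}]. *)
Definition ramp (e c x : R) : R := Num.max 0 (Num.min 1 ((squash x - c) / e)).

Lemma ramp_continuous e c : continuous (ramp e c).
Proof.
move=> x; apply: (@continuous_max R _ (cst 0)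
  (cst 1 \min (fun y => (squash y - c) / e : R^o))); first exact: cvg_cst.
apply: continuous_min; first exact: cvg_cst.
apply: cvgM; last exact: cvg_cst.
by apply: cvgB; [exact: squash_continuous|exact: cvg_cst].
Qed.

Lemma ramp01 e c x : 0 <= ramp e c x <= 1.
Proof. by rewrite /ramp le_max lexx /= ge_max ler01 ge_min lexx. Qed.

Lemma ramp_eq0 e c x : 0 < e -> squash x < c -> ramp e c x = 0.
Proof.
move=> e0 xc; rewrite /ramp max_l // ge_min; apply/orP; right.
by rewrite ler_pdivrMr // mul0r subr_le0 ltW.
Qed.

Lemma ramp_eq1 e c x : 0 < e -> c + e <= squash x -> ramp e c x = 1.
Proof.
move=> e0 xc; rewrite /ramp min_l; first by rewrite max_r // ler01.
by rewrite ler_pdivlMr // mul1r lerBrDl.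
Qed.

(** A parameter -1 drops its constraint and a parameter 1 empties the set, so half-planes and
    extreme cases need no separate form. *)
Definition squash_wedge (a b : R) : set (R * R) :=
  [set x | a <= squash x.1 /\ b <= squash x.2].

Lemma squash_measurable : measurable_fun [set: R] squash.
Proof. by apply: continuous_measurable_fun; exact: squash_continuous. Qed.

Lemma measurable_squash1 (A : set R) : measurable A ->
  measurable [set x : R * R | A (squash x.1)].
Proof.
move=> mA; rewrite -[X in measurable X]setTI.
exact: (measurableT_comp squash_measurable measurable_fst) measurableT A mA.
Qed.

Lemma measurable_squash2 (A : set R) : measurable A ->
  measurable [set x : R * R | A (squash x.2)].
Proof.
move=> mA; rewrite -[X in measurable X]setTI.
exact: (measurableT_comp squash_measurable measurable_snd) measurableT A mA.
Qed.

Lemma measurable_squash_wedge a b : measurable (squash_wedge a b).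
Proof.
have -> : squash_wedge a b = [set x | squash x.1 \in `[a, +oo[] `&`
    [set x | squash x.2 \in `[b, +oo[].
  by apply/seteqP; split => x /=; rewrite !in_itv /= !andbT.
by apply: measurableI; [exact: (measurable_squash1 (measurable_itv `[a, +oo[))
  |exact: (measurable_squash2 (measurable_itv `[b, +oo[))].
Qed.

Lemma squash_wedgeS a b a' b' : a' <= a -> b' <= b ->
  squash_wedge a b `<=` squash_wedge a' b'.
Proof. by move=> aa bb x [xa xb]; split; [exact: le_trans xa|exact: le_trans xb]. Qed.

Lemma squash_wedge_setT a b : a <= -1 -> b <= -1 -> squash_wedge a b = setT.
Proof.
move=> a1 b1; apply/seteqP; split => // x _.
by split; [apply: le_trans a1 _|apply: le_trans b1 _]; exact/ltW/squash_gtN1.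
Qed.

Lemma squash_wedge_set0 a b : 1 <= a \/ 1 <= b -> squash_wedge a b = set0.
Proof.
move=> ab; apply/seteqP; split => // x [xa xb].
by have := squash_lt1 x.1; have := squash_lt1 x.2; case: ab; lra.
Qed.

Lemma lebesgue2_fst0 (A : set R) : measurable A -> lebesgue_measure A = 0%E ->
  lebesgue2 (A `*` setT) = 0%E.
Proof.
move=> mA A0; transitivity (lebesgue_measure A * lebesgue_measure [set: R])%E.
  exact: product_measure1E.
by rewrite A0 mul0e.
Qed.

Lemma lebesgue2_snd0 (A : set R) : measurable A -> lebesgue_measure A = 0%E ->
  lebesgue2 (setT `*` A) = 0%E.
Proof.
move=> mA A0; transitivity (lebesgue_measure [set: R] * lebesgue_measure A)%E.
  exact: product_measure1E.
by rewrite A0 mule0.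
Qed.

Lemma squash_fiber c :
  measurable (squash @^-1` [set c]) /\ lebesgue_measure (squash @^-1` [set c]) = 0%E.
Proof.
have [[x xc]|H] := pselect (exists x, squash x = c).
  have -> : squash @^-1` [set c] = [set x].
    apply/seteqP; split => y /=; last by move=> ->.
    by rewrite -xc => /(inc_inj squash_increasing).
  by rewrite lebesgue_measure_set1.
have -> : squash @^-1` [set c] = set0.
  by apply/seteqP; split => y //= yc; case: H; exists y.
by rewrite measure0.
Qed.

Section Mass.
Variable mu : probability (R * R)%type R.
Hypothesis mu_ac : mass_distribution mu.

Lemma mass_squash1 c : measurable [set x : R * R | squash x.1 = c] /\
  mu [set x : R * R | squash x.1 = c] = 0%E.
Proof.
have [mc c0] := squash_fiber c.
have -> : [set x : R * R | squash x.1 = c] = (squash @^-1` [set c]) `*` setT.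
  by apply/seteqP; split => x //= [].
have mX : measurable ((squash @^-1` [set c]) `*` [set: R]) by exact: measurableX.
by split => //; apply: mu_ac => //; exact: lebesgue2_fst0.
Qed.

Lemma mass_squash2 c : measurable [set x : R * R | squash x.2 = c] /\
  mu [set x : R * R | squash x.2 = c] = 0%E.
Proof.
have [mc c0] := squash_fiber c.
have -> : [set x : R * R | squash x.2 = c] = setT `*` (squash @^-1` [set c]).
  by apply/seteqP; split => x //= [].
have mX : measurable ([set: R] `*` (squash @^-1` [set c])) by exact: measurableX.
by split => //; apply: mu_ac => //; exact: lebesgue2_snd0.
Qed.

Lemma mass_fin A : measurable A -> mu A \is a fin_num.
Proof. exact: fin_num_measure. Qed.

Lemma mass_le A B : measurable A -> measurable B -> A `<=` B ->
  fine (mu A) <= fine (mu B).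
Proof.
by move=> mA mB AB; rewrite fine_le ?mass_fin // le_measure ?inE.
Qed.

(** The two sets differ by parts of two axis-parallel lines, which are null by absolute
    continuity. *)
Lemma mass_squash_wedge_open a b :
  mu [set x : R * R | a < squash x.1 /\ b < squash x.2] = mu (squash_wedge a b).
Proof.
have [m1 z1] := mass_squash1 a; have [m2 z2] := mass_squash2 b.
set O := [set x | _].
have mO : measurable O.
  have -> : O = [set x | squash x.1 \in `]a, +oo[] `&`
      [set x | squash x.2 \in `]b, +oo[].
    by apply/seteqP; split => x /=; rewrite !in_itv /= !andbT.
  by apply: measurableI; [exact: (measurable_squash1 (measurable_itv `]a, +oo[))
    |exact: (measurable_squash2 (measurable_itv `]b, +oo[))].
set N := [set x : R * R | squash x.1 = a] `|` [set x | squash x.2 = b].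
have mN : measurable N by exact: measurableU.
have N0 : mu N = 0%E by rewrite measureU0.
apply/eqP; rewrite eq_le; apply/andP; split.
  rewrite le_measure ?inE //; first exact: measurable_squash_wedge.
  by move=> x [/ltW ? /ltW ?].
rewrite -(measureU0 mO mN N0) le_measure ?inE //.
- exact: measurable_squash_wedge.
- exact: measurableU.
move=> x [/= xa xb]; rewrite /O /N /= .
move: xa; rewrite le_eqVlt => /orP[/eqP ->|xa]; first by right; left.
move: xb; rewrite le_eqVlt => /orP[/eqP ->|xb]; first by right; right.
by left.
Qed.

(** The enlarged wedges decrease to the closed wedge and the shrunk ones increase to the open wedge,
    which has the same mass. Moving both parameters together suffices because wedges are monotone in
    each. *)
Lemma mass_diagonal_continuous a b e : 0 < e -> exists2 r, 0 < r &
  fine (mu (squash_wedge (a - r) (b - r))) < fine (mu (squash_wedge a b)) + e /\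
  fine (mu (squash_wedge a b)) - e < fine (mu (squash_wedge (a + r) (b + r))).
Proof.
move=> e0; pose h k : R := k.+1%:R^-1.
have h0 k : 0 < h k by rewrite invr_gt0.
have hh m k : (m <= k)%N -> h k <= h m.
  by move=> mk; rewrite lef_pV2 ?posrE // ler_nat.
have h_small (y : R) : 0 < y -> exists k, h k < y.
  move=> y0; have [M _ HM] := near_infty_natSinv_lt (PosNum y0).
  by exists M; apply: HM => /=.
pose F k := squash_wedge (a - h k) (b - h k).
pose G k := squash_wedge (a + h k) (b + h k).
have FI : \bigcap_k F k = squash_wedge a b.
  apply/seteqP; split => x.
    move=> H; split; apply/ler_addgt0Pr => y /h_small[k ky];
      have [] := H k I; lra.
  by move=> xw k _; apply: squash_wedgeS xw; have := h0 k; lra.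
have GU : \bigcup_k G k = [set x | a < squash x.1 /\ b < squash x.2].
  apply/seteqP; split => x.
    by move=> [k _ [xa xb]]; have := h0 k; split; lra.
  move=> [xa xb]; have [|k hk] := h_small (Num.min (squash x.1 - a) (squash x.2 - b)).
    by rewrite lt_min !subr_gt0 xa xb.
  by exists k => //; move: hk; rewrite lt_min => /andP[? ?]; split; lra.
have mF k : measurable (F k) by exact: measurable_squash_wedge.
have mG k : measurable (G k) by exact: measurable_squash_wedge.
have mW := measurable_squash_wedge a b.
have cF : (fine \o (mu \o F)) @ \oo --> fine (mu (squash_wedge a b)).
  apply: fine_cvg; rewrite fineK ?mass_fin // -FI.
  apply: nonincreasing_cvg_mu => //; rewrite ?FI //.
    by rewrite ltey_eq mass_fin.
  move=> m k mk; apply/subsetPset/squash_wedgeS; have := hh _ _ mk; lra.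
have cG : (fine \o (mu \o G)) @ \oo --> fine (mu (squash_wedge a b)).
  apply: fine_cvg; rewrite fineK ?mass_fin // -mass_squash_wedge_open -GU.
  apply: nondecreasing_cvg_mu => //; first exact: bigcupT_measurable.
  move=> m k mk; apply/subsetPset/squash_wedgeS; have := hh _ _ mk; lra.
move/cvgrPdist_lt: cF => /(_ _ e0) [M1 _ H1].
move/cvgrPdist_lt: cG => /(_ _ e0) [M2 _ H2].
exists (h (maxn M1 M2)) => //.
have := H1 (maxn M1 M2) (leq_maxl _ _); have := H2 (maxn M1 M2) (leq_maxr _ _).
by rewrite /= !ltr_norml /F /G; lra.
Qed.

Definition wedge_bump (e a b : R) (x : R * R) : R :=
  ramp e a x.1 * ramp e b x.2.

Lemma wedge_bump01 e a b (x : R * R) : 0 <= wedge_bump e a b x <= 1.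
Proof.
have /andP[? ?] := ramp01 e a x.1; have /andP[? ?] := ramp01 e b x.2.
by rewrite mulr_ge0 //= mulr_ile1.
Qed.

Lemma wedge_bump_continuous e a b : continuous (wedge_bump e a b).
Proof.
move=> x; apply: cvgM.
  by apply: (@continuous_comp _ _ _ fst (ramp e a)); [exact: cvg_fst|exact: ramp_continuous].
by apply: (@continuous_comp _ _ _ snd (ramp e b)); [exact: cvg_snd|exact: ramp_continuous].
Qed.

Lemma wedge_bump_measurable e a b :
  measurable_fun [set: R * R] (wedge_bump e a b).
Proof.
apply: measurable_funM.
  exact: (measurableT_comp (continuous_measurable_fun (@ramp_continuous e a)) measurable_fst).
exact: (measurableT_comp (continuous_measurable_fun (@ramp_continuous e b)) measurable_snd).
Qed.

(** The bump is 1 on the wedge shrunk by [e] and 0 off the wedge, so it lies between the two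
    indicators. *)
Lemma wedge_bump_integral e a b : 0 < e ->
  fine (mu (squash_wedge (a + e) (b + e))) <=
    fine (\int[mu]_x (wedge_bump e a b x)%:E) <= fine (mu (squash_wedge a b)).
Proof.
move=> e0.
have mE : measurable_fun [set: R * R] (EFin \o wedge_bump e a b).
  by apply/measurable_EFinP; exact: wedge_bump_measurable.
have mI c d : measurable_fun [set: R * R] (EFin \o (\1_(squash_wedge c d) : R * R -> R)).
  by apply/measurable_EFinP; apply: measurable_indic; exact: measurable_squash_wedge.
have iI c d : (\int[mu]_x (\1_(squash_wedge c d) x)%:E = mu (squash_wedge c d))%E.
  by rewrite integral_indic ?setIT //; exact: measurable_squash_wedge.
have b0 (x : R * R) : (0 <= (wedge_bump e a b x)%:E)%E.
  by rewrite lee_fin; have /andP[] := wedge_bump01 e a b x.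
have lo : (mu (squash_wedge (a + e) (b + e)) <= \int[mu]_x (wedge_bump e a b x)%:E)%E.
  rewrite -iI; apply: ge0_le_integral => [//|x _||//|x _]; first by rewrite lee_fin.
    exact: mI.
  rewrite lee_fin indicE; have [|_] := boolP (x \in squash_wedge (a + e) _); last first.
    by have /andP[] := wedge_bump01 e a b x.
  rewrite inE => -[xa xb].
  by rewrite /wedge_bump !ramp_eq1 // mulr1.
have hi : (\int[mu]_x (wedge_bump e a b x)%:E <= mu (squash_wedge a b))%E.
  rewrite -iI; apply: ge0_le_integral => [//|x _ //|//||x _]; first exact: mI.
  rewrite lee_fin indicE.
  have [xw|xw] := boolP (x \in squash_wedge a b).
    by have /andP[] := wedge_bump01 e a b x.
  rewrite /wedge_bump.
  have [xa|xa] := ltP (squash x.1) a; first by rewrite ramp_eq0 // mul0r.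
  have [xb|xb] := ltP (squash x.2) b; first by rewrite (@ramp_eq0 _ b) // mulr0.
  by move: xw; rewrite notin_setE /squash_wedge /= => -[].
have fW c d := mass_fin (measurable_squash_wedge c d).
have fI : (\int[mu]_x (wedge_bump e a b x)%:E)%E \is a fin_num.
  rewrite ge0_fin_numE ?integral_ge0 //.
  by rewrite (le_lt_trans hi) // ltey_eq fW.
by rewrite !fine_le.
Qed.

End Mass.

End Squash.

(** * The excess over one half: continuity and boundary symmetries *)

Section WedgeMass.
Variables (R : realType) (n : nat) (mu : 'rV[R]_n.+2 -> probability (R * R)%type R).
Hypothesis hmu : mass_assignment mu.
Implicit Types (u : 'rV[R]_n.+2) (a b : R).

Definition excess (v : 'rV[R]_n.+2 * R * R) : R :=
  fine (mu v.1.1 (squash_wedge v.1.2 v.2)) - 1 / 2.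

Lemma bump_integral_near u e a b r : horizontal_unit u -> 0 < r ->
  exists2 s, 0 < s & forall w, horizontal_unit w -> ball u s w ->
  `|fine (\int[mu u]_x (wedge_bump e a b x)%:E)
    - fine (\int[mu w]_x (wedge_bump e a b x)%:E)| < r.
Proof.
move=> uS r0; have [_ _ mu_cont] := hmu.
have bnd : exists M : R, forall x, `|wedge_bump e a b x| <= M.
  exists 1 => x; have /andP[x0 x1] := wedge_bump01 e a b x.
  by rewrite ger0_norm.
have := mu_cont _ (@wedge_bump_continuous _ e a b) bnd.
rewrite subspace_continuousP => /(_ u uS)/cvgrPdist_lt/(_ _ r0).
rewrite near_withinE => /nbhs_ballP[s /= s0 Hs].
by exists s => // w wS uw; exact: Hs.
Qed.

(** Weak continuity applies to fixed test functions only. Two fixed bumps around the wedge at (a, b)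
    therefore control the change of direction, and monotonicity controls the change of (a, b). *)
Lemma excess_continuous : {within @cylinder R n, continuous excess}.
Proof.
apply/subspace_continuousP => -[[u a] b] [[/= uS _] _].
apply/cvgrPdist_lt => e e0; have e2 : 0 < e / 2 by rewrite divr_gt0.
have [mu_ac _ _] := hmu.
have [r r0 [lo hi]] := mass_diagonal_continuous (mu_ac u uS) a b e2.
have d0 : 0 < r / 2 by rewrite divr_gt0.
(* The first bump is supported in the wedge enlarged by [r] and is 1 on the one enlarged by [r / 2];
   the second is supported in the wedge shrunk by [r / 2] and is 1 on the one shrunk by [r].
   Parameters within [r / 2] of (a, b) give wedges in between. *)
have [s1 s10 H1] := bump_integral_near (r / 2) (a - r) (b - r) uS e2.
have [s2 s20 H2] := bump_integral_near (r / 2) (a + r / 2) (b + r / 2) uS e2.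
rewrite near_withinE; apply/nbhs_ballP.
exists (Num.min (r / 2) (Num.min s1 s2)); first by rewrite /= !lt_min d0 s10.
move=> [[w a'] b'] [[/= uw aa] bb] [[/= wS _] _].
have {}aa : `|a - a'| < r / 2 by apply: lt_le_trans aa _; rewrite ge_min lexx.
have {}bb : `|b - b'| < r / 2 by apply: lt_le_trans bb _; rewrite ge_min lexx.
have := H1 w wS (le_ball _ uw); rewrite !ge_min lexx orbT => /(_ isT) {}H1.
have := H2 w wS (le_ball _ uw); rewrite !ge_min lexx !orbT => /(_ isT) {}H2.
have /andP[_ I1] := wedge_bump_integral (mu u) (a - r) (b - r) d0.
have /andP[I2 _] := wedge_bump_integral (mu w) (a - r) (b - r) d0.
have /andP[I3 _] := wedge_bump_integral (mu u) (a + r / 2) (b + r / 2) d0.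
have /andP[_ I4] := wedge_bump_integral (mu w) (a + r / 2) (b + r / 2) d0.
have J1 : fine (mu w (squash_wedge a' b')) <=
    fine (mu w (squash_wedge (a - r + r / 2) (b - r + r / 2))).
  apply: mass_le; [exact: measurable_squash_wedge|
    exact: measurable_squash_wedge|apply: squash_wedgeS].
    by move: aa; rewrite ltr_norml; lra.
  by move: bb; rewrite ltr_norml; lra.
have J2 : fine (mu w (squash_wedge (a + r / 2) (b + r / 2))) <=
    fine (mu w (squash_wedge a' b')).
  apply: mass_le; [exact: measurable_squash_wedge|
    exact: measurable_squash_wedge|apply: squash_wedgeS].
    by move: aa; rewrite ltr_norml; lra.
  by move: bb; rewrite ltr_norml; lra.
have rr c : c + r / 2 + r / 2 = c + r by field.
rewrite !rr in I3.
rewrite /from_subspace /excess /=; move: H1 H2; rewrite !ltr_norml; lra.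
Qed.

(** After the flip, the half-plane at [- a] is the complement of the half-plane at [a] together with
    the boundary line, which is null. *)
Lemma excess_odd u a : horizontal_unit u ->
  excess (- u, - a, -1) = - excess (u, a, -1).
Proof.
move=> uS; have [mu_ac mu_flip _] := hmu; rewrite /excess /=.
rewrite mu_flip //; last exact: measurable_squash_wedge.
have [m1 z1] := mass_squash1 (mu_ac u uS) a.
have mW : measurable (squash_wedge a (-1)) by exact: measurable_squash_wedge.
have mC : measurable (~` squash_wedge a (-1)) by exact: measurableC.
have -> : @hflip R @^-1` squash_wedge (- a) (-1) =
    ~` squash_wedge a (-1) `|` [set x | squash x.1 = a].
  apply/seteqP; split => x; rewrite /squash_wedge /hflip /= squashN.
    move=> [xa _]; have [xa'|xa'] := ltP (squash x.1) a; last by right; lra.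
    by left=> -[].
  move=> H; split; last exact/ltW/squash_gtN1.
  rewrite lerN2; case: H => [H|->//]; rewrite leNgt; apply/negP => ax.
  by apply: H; split; [exact: ltW|exact/ltW/squash_gtN1].
have -> : mu u (~` squash_wedge a (-1) `|` [set x | squash x.1 = a]) =
    (1 - mu u (squash_wedge a (-1)))%E.
  by rewrite measureU0 //; exact: probability_setC.
rewrite fineB ?mass_fin //=; clear; lra.
Qed.

Lemma excess_side u a b : horizontal_unit u -> a = 1 \/ a = -1 ->
  excess (- u, a, b) = excess (u, a, b).
Proof.
move=> uS [->|->]; rewrite /excess /=.
  by rewrite !squash_wedge_set0 ?measure0 //; left.
have [_ mu_flip _] := hmu.
rewrite mu_flip //; last exact: measurable_squash_wedge.
congr (fine (mu u _) - _); apply/seteqP; split => x [/= _ xb];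
  by split => //; exact/ltW/squash_gtN1.
Qed.

Lemma excess_top u a : excess (- u, - a, 1) = excess (u, a, 1).
Proof. by rewrite /excess /= !squash_wedge_set0 ?measure0 //; right. Qed.

End WedgeMass.

(** * From mass one half to bisecting axis-parallel wedges *)

(** The closure of the complement exceeds the complement only by its overlap with [W], which is
    null. *)
Lemma bisects_half (R : realType) (mu : probability (R * R)%type R)
    (W C N : set (R * R)) :
  measurable W -> measurable C -> measurable N -> mu N = 0%E ->
  closure (~` W) = C -> W `&` C `<=` N -> fine (mu W) = 1 / 2 -> bisects mu W.
Proof.
move=> mW mC mN N0 WC WCN half; rewrite /bisects WC.
have mWC : measurable (W `&` C) by exact: measurableI.
have WE : mu W = (1 / 2)%:E by rewrite -half fineK // mass_fin.
have -> : C = ~` W `|` (W `&` C).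
  apply/seteqP; split => x; last by case=> [/subset_closure|[]]; rewrite ?WC.
  by move=> Cx; have [Wx|Wx] := pselect (W x); [right|left].
rewrite measureU0 //; last exact: subset_measure0 N0.
  transitivity (1 - mu W)%E; last exact/esym/probability_setC.
  by rewrite WE -EFinB; congr EFin; field.
exact: measurableC.
Qed.

Section ClosureOfComplement.
Variable R : realType.
Implicit Types (A B : R).

Lemma closure_complE (W C : set (R * R)) : closed C -> ~` W `<=` C ->
  (forall x, C x -> forall e, 0 < e -> exists2 y, ~ W y & ball x e y) ->
  closure (~` W) = C.
Proof.
move=> cC WC CW; apply/seteqP; split.
  by rewrite [X in _ `<=` X](closure_id C).1 //; exact: closureS.
move=> x Cx U /nbhs_ballP[e /= e0 eU].
by have [y Wy xy] := CW x Cx e e0; exists y; split => //; exact: eU.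
Qed.

Lemma closed_fst_le A : closed [set x : R * R | x.1 <= A].
Proof.
apply: (@preimage_closed (R * R)%type R fst [set y | y <= A]); last exact: closed_le.
by move=> x _; exact: cvg_fst.
Qed.

Lemma closed_snd_le B : closed [set x : R * R | x.2 <= B].
Proof.
apply: (@preimage_closed (R * R)%type R snd [set y | y <= B]); last exact: closed_le.
by move=> x _; exact: cvg_snd.
Qed.

(** Shifts to the left or downwards leave the wedge from any of its boundary points; they show that
    the closure of the complement contains the boundary. *)
Lemma ball_left (x : R * R) (e : R) : 0 < e -> ball x e (x.1 - e / 2, x.2).
Proof.
move=> e0; split; last exact: ballxx.
by rewrite /ball /= opprB addrC subrK ger0_norm; lra.
Qed.

Lemma ball_down (x : R * R) (e : R) : 0 < e -> ball x e (x.1, x.2 - e / 2).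
Proof.
move=> e0; split; first exact: ballxx.
by rewrite /ball /= opprB addrC subrK ger0_norm; lra.
Qed.

Lemma closure_compl_right A : closure (~` [set x : R * R | A <= x.1]) = [set x : R * R | x.1 <= A].
Proof.
apply: closure_complE; first exact: closed_fst_le.
  by move=> x /negP; rewrite -ltNge => /ltW.
move=> x /= xA e e0; exists (x.1 - e / 2, x.2); last exact: ball_left.
by move=> /=; lra.
Qed.

Lemma closure_compl_up B : closure (~` [set x : R * R | B <= x.2]) = [set x : R * R | x.2 <= B].
Proof.
apply: closure_complE; first exact: closed_snd_le.
  by move=> x /negP; rewrite -ltNge => /ltW.
move=> x /= xB e e0; exists (x.1, x.2 - e / 2); last exact: ball_down.
by move=> /=; lra.
Qed.

Lemma closure_compl_quadrant A B :
  closure (~` [set x : R * R | A <= x.1 /\ B <= x.2]) =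
  [set x : R * R | x.1 <= A] `|` [set x : R * R | x.2 <= B].
Proof.
apply: closure_complE.
- by apply: closedU; [exact: closed_fst_le|exact: closed_snd_le].
- move=> x /= H; have [xA|xA] := leP x.1 A; first by left.
  by right; rewrite leNgt; apply/negP => /ltW xB; apply: H; split => //; exact: ltW.
move=> x [/= xA|/= xB] e e0.
  by exists (x.1 - e / 2, x.2); [move=> /=; lra|exact: ball_left].
by exists (x.1, x.2 - e / 2); [move=> /=; lra|exact: ball_down].
Qed.

Lemma measurable_fst_itv (i : interval R) : measurable [set x : R * R | x.1 \in i].
Proof.
rewrite -[X in measurable X]setTI.
exact: measurable_fst measurableT _ (measurable_itv i).
Qed.

Lemma measurable_snd_itv (i : interval R) : measurable [set x : R * R | x.2 \in i].
Proof.
rewrite -[X in measurable X]setTI.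
exact: measurable_snd measurableT _ (measurable_itv i).
Qed.

Lemma squash_leE a (y : R) : -1 < a < 1 -> (a <= squash y) = (a / (1 - `|a|) <= y).
Proof. by move=> a1; rewrite -{1}(squash_inv a1) squash_increasing. Qed.

(* [squash] is injective, so these are the lines [x.1 = c] and [x.2 = c']. *)
Lemma mass_boundary (mu : probability (R * R)%type R) c c' :
  mass_distribution mu ->
  measurable ([set x | squash x.1 = squash c] `|` [set x | squash x.2 = squash c']) /\
  mu ([set x | squash x.1 = squash c] `|` [set x | squash x.2 = squash c']) = 0%E.
Proof.
move=> mu_ac; have [m1 z1] := mass_squash1 mu_ac (squash c).
have [m2 z2] := mass_squash2 mu_ac (squash c').
by split; [exact: measurableU|rewrite measureU0].
Qed.

(** A parameter -1 is an infinite corner coordinate. The four cases are the whole plane, which is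
    excluded, two kinds of half-plane, and the quadrant with corner (A, B). *)
Lemma squash_wedge_axis_wedge a b : -1 <= a < 1 -> -1 <= b < 1 ->
  squash_wedge a b <> setT ->
  axis_wedge (squash_wedge a b) /\
  forall mu : probability (R * R)%type R, mass_distribution mu ->
    fine (mu (squash_wedge a b)) = 1 / 2 -> bisects mu (squash_wedge a b).
Proof.
move=> /andP[a0 a1] /andP[b0 b1] WT.
pose A := a / (1 - `|a|); pose B := b / (1 - `|b|).
have mW := measurable_squash_wedge a b.
have m1 : measurable [set x : R * R | x.1 <= A].
  have -> : [set x : R * R | x.1 <= A] = [set x | x.1 \in `]-oo, A]].
    by apply/seteqP; split => x /=; rewrite in_itv.
  exact: measurable_fst_itv.
have m2 : measurable [set x : R * R | x.2 <= B].
  have -> : [set x : R * R | x.2 <= B] = [set x | x.2 \in `]-oo, B]].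
    by apply/seteqP; split => x /=; rewrite in_itv.
  exact: measurable_snd_itv.
have gtN1 (y : R) : -1 <= squash y by exact/ltW/squash_gtN1.
have [aN1|aN1] := eqVneq a (-1); have [bN1|bN1] := eqVneq b (-1).
- by case: WT; apply: squash_wedge_setT; rewrite ?aN1 ?bN1.
- have bI : -1 < b < 1 by rewrite lt_neqAle eq_sym bN1 b0.
  have WE : squash_wedge a b = [set x | B <= x.2].
    apply/seteqP; split => x; rewrite /squash_wedge /= aN1 (squash_leE _ bI); first by case.
    by split.
  split.
    (* A horizontal boundary line leaves the abscissa of the corner free; 0 is an arbitrary choice,
       made again for the null set below. *)
    exists 0, B, true, true; right; right; right; rewrite WE.
    by apply/seteqP; split => x /=; rewrite /sgnb mul1r subr_ge0.
  move=> mu mu_ac; rewrite WE => half; have [mN N0] := mass_boundary 0 B mu_ac.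
  apply: (bisects_half _ m2 mN N0 _ _ half); rewrite -?WE //.
    by rewrite WE; exact: closure_compl_up.
  move=> x []; rewrite WE /= => x1 x2; right => /=; congr squash.
  by apply/eqP; rewrite eq_le x1 x2.
- have aI : -1 < a < 1 by rewrite lt_neqAle eq_sym aN1 a0.
  have WE : squash_wedge a b = [set x | A <= x.1].
    apply/seteqP; split => x; rewrite /squash_wedge /= bN1 (squash_leE _ aI); first by case.
    by split.
  split.
    exists A, 0, true, true; right; right; left; rewrite WE.
    by apply/seteqP; split => x /=; rewrite /sgnb mul1r subr_ge0.
  move=> mu mu_ac; rewrite WE => half; have [mN N0] := mass_boundary A 0 mu_ac.
  apply: (bisects_half _ m1 mN N0 _ _ half); rewrite -?WE //.
    by rewrite WE; exact: closure_compl_right.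
  move=> x []; rewrite WE /= => x1 x2; left => /=; congr squash.
  by apply/eqP; rewrite eq_le x1 x2.
- have aI : -1 < a < 1 by rewrite lt_neqAle eq_sym aN1 a0.
  have bI : -1 < b < 1 by rewrite lt_neqAle eq_sym bN1 b0.
  have WE : squash_wedge a b = [set x | A <= x.1 /\ B <= x.2].
    by apply/seteqP; split => x; rewrite /squash_wedge /= (squash_leE _ aI) (squash_leE _ bI).
  split.
    exists A, B, true, true; left; rewrite WE /quadrant.
    by apply/seteqP; split => x /=; rewrite /sgnb !mul1r !subr_ge0.
  move=> mu mu_ac; rewrite WE => half; have [mN N0] := mass_boundary A B mu_ac.
  apply: (bisects_half _ (measurableU _ _ m1 m2) mN N0 _ _ half); rewrite -?WE //.
    by rewrite WE; exact: closure_compl_quadrant.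
  move=> x []; rewrite WE /= => -[x1 x2] [x3|x4]; [left|right] => /=; congr squash;
    by apply/eqP; rewrite eq_le ?x1 ?x2 ?x3 ?x4.
Qed.

End ClosureOfComplement.

Theorem theorem1p6 (R : realType) (d : nat) (hd : (2 <= d)%N)
  (mu : 'I_d -> 'rV[R]_d -> probability (R * R)%type R)
  (hmu : forall k, mass_assignment (mu k)) :
  exists u : 'rV[R]_d, horizontal_unit u /\
    exists W : set (R * R)%type, axis_wedge W /\
      forall k, bisects (mu k u) W.
Proof.
case: d hd mu hmu => [|[|n]] // _ mu hmu.
have [||||[[u a] b] [[/= uS ab] bb] zero] := @common_zero R n (fun k => excess (mu k)).
- by move=> j; exact: excess_continuous.
- by move=> j u a uS _; exact: excess_odd.
- by move=> j u a b; exact: excess_side.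
- by move=> j u a _ _; exact: excess_top.
have half k : fine (mu k u (squash_wedge a b)) = 1 / 2.
  by have := zero k; rewrite /excess /= => /eqP; rewrite subr_eq0 => /eqP.
(* Mass one half excludes the empty set and the whole plane, and thus the parameters that encode no
   wedge. *)
have ne0 : squash_wedge a b <> set0.
  by move=> W0; have := half ord0; rewrite W0 measure0 /=; lra.
have neT : squash_wedge a b <> setT.
  by move=> W1; have := half ord0; rewrite W1 probability_setT /=; lra.
have a1 : -1 <= a < 1.
  move: ab; rewrite in_itv /= => /andP[-> _]; rewrite ltNge; apply/negP => a1.
  by apply: ne0; apply: squash_wedge_set0; left.
have b1 : -1 <= b < 1.
  move: bb; rewrite in_itv /= => /andP[-> _]; rewrite ltNge; apply/negP => b1.
  by apply: ne0; apply: squash_wedge_set0; right.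
have [W_axis W_bis] := squash_wedge_axis_wedge a1 b1 neT.
exists u; split => //; exists (squash_wedge a b); split => // k.
by apply: W_bis; [have [+ _ _] := hmu k; exact|exact: half].
Qed.
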